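(* Let $H$ be a left-symmetric bialgebra and let $A$ be a left-symmetric algebra and a left-symmetric coalgebra in ${}^{H}_{H}\mathcal{M}{}^{H}_{H}$, with structure maps $\triangleright:H\otimes A\to A$, $\triangleleft:A\otimes H\to A$, $\phi:A\to H\otimes A$, $\psi:A\to A\otimes H$. On the vector space $E:=A\oplus H$ define, for $a,b\in A$ and $x,y\in H$, $$(a,x)(b,y):=(ab+x\triangleright b+a\triangleleft y,\;xy),\qquad \Delta_E(a,x):=\Delta_A(a)+\phi(a)+\psi(a)+\Delta_H(x).$$ Then $E$ with this product and coproduct is a left-symmetric bialgebra if and only if $A$ is a braided left-symmetric bialgebra in ${}^{H}_{H}\mathcal{M}{}^{H}_{H}$.
   Context: All vector spaces are over a fixed field of characteristic zero. $\tau(u\otimes v)=v\otimes u$, $\tau_{12}(u\otimes v\otimes w)=v\otimes u\otimes w$, $[a,b]:=ab-ba$; summation signs in $\Delta(a)=a_1\otimes a_2$ etc. are suppressed. A left-symmetric algebra is a vector space with a bilinear product satisfying $(ab)c-a(bc)=(ba)c-b(ac)$. A left-symmetric coalgebra is a vector space $C$ with a linear map $\Delta:C\to C\otimes C$ such that $(\Delta\otimes\mathrm{id})\Delta(c)-(\mathrm{id}\otimes\Delta)\Delta(c)$ is fixed by $\tau_{12}$ for all $c$. A left-symmetric bialgebra is a vector space which is both, with, for all $a,b$, $\Delta([a,b])=ab_1\otimes b_2+b_1\otimes[a,b_2]-ba_1\otimes a_2-a_1\otimes[b,a_2]$ and $(\mathrm{id}-\tau)\Delta(ab)=(\mathrm{id}-\tau)(a_1\otimes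 a_2b+ab_1\otimes b_2+b_1\otimes ab_2)$. Write $\phi(v)=v_{(-1)}\otimes v_{(0)}$, $\psi(v)=v_{(0)}\otimes v_{(1)}$. Below $x,y\in H$. $V$ is an $H$-bimodule via $\triangleright:H\otimes V\to V$, $\triangleleft:V\otimes H\to V$ if $(xy)\triangleright v-x\triangleright(y\triangleright v)=(yx)\triangleright v-y\triangleright(x\triangleright v)$ and $(v\triangleleft x)\triangleleft y-v\triangleleft(xy)=(x\triangleright v)\triangleleft y-x\triangleright(v\triangleleft y)$. $V$ is an $H$-bicomodule via $\phi:V\to H\otimes V$, $\psi:V\to V\otimes H$ if $\Delta_H(v_{(-1)})\otimes v_{(0)}-v_{(-1)}\otimes\phi(v_{(0)})$ is fixed by $\tau_{12}$ and $\psi(v_{(0)})\otimes v_{(1)}-v_{(0)}\otimes\Delta_H(v_{(1)})=\tau_{12}\big(\phi(v_{(0)})\otimes v_{(1)}-v_{(-1)}\otimes\psi(v_{(0)})\big)$. $V$ is a left-symmetric Hopf bimodule over $H$ (an object of ${}^{H}_{H}\mathcal{M}{}^{H}_{H}$) if it is an $H$-bimodule and an $H$-bicomodule and - $\phi(v\triangleleft x)-\phi(x\triangleright v)=v_{(-1)}\otimes(v_{(0)}\triangleleft x)+x_1\otimes(v\triangleleft x_2)-x_1\otimes(x_2\triangleright v)-xv_{(-1)}\otimes v_{(0)}-v_{(-1)}\otimes(x\triangleright v_{(0)})$; - $\psi(x\triangleright v)-\psi(v\triangleleft x)=(x\triangleright v_{(0)})\otimes v_{(1)}+v_{(0)}\otimes[x,v_{(1)}]-(v\triangleleft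 x_1)\otimes x_2$; - $\phi(x\triangleright v)-\tau\psi(x\triangleright v)=x_1\otimes(x_2\triangleright v)+xv_{(-1)}\otimes v_{(0)}+v_{(-1)}\otimes(x\triangleright v_{(0)})-v_{(1)}\otimes(x\triangleright v_{(0)})-xv_{(1)}\otimes v_{(0)}$; - $\phi(v\triangleleft x)-\tau\psi(v\triangleleft x)=v_{(-1)}\otimes(v_{(0)}\triangleleft x)+x_1\otimes(v\triangleleft x_2)-v_{(1)}x\otimes v_{(0)}-x_2\otimes(v\triangleleft x_1)$. $A$ is a left-symmetric algebra and a left-symmetric coalgebra in ${}^{H}_{H}\mathcal{M}{}^{H}_{H}$ if $A$ is a left-symmetric algebra, a left-symmetric coalgebra, a left-symmetric Hopf bimodule over $H$, and - (bimodule algebra) $x\triangleright(ab)-(x\triangleright a)b=a(x\triangleright b)-(a\triangleleft x)b$ and $(ab)\triangleleft x-a(b\triangleleft x)=(ba)\triangleleft x-b(a\triangleleft x)$; - (bicomodule coalgebra) $a_{(-1)}\otimes\Delta_A(a_{(0)})-\phi(a_1)\otimes a_2=\tau_{12}\big(a_1\otimes\phi(a_2)-\psi(a_1)\otimes a_2\big)$, and $\Delta_A(a_{(0)})\otimes a_{(1)}-a_1\otimes\psi(a_2)$ is fixed by $\tau_{12}$; - (bimodule coalgebra) $\Delta_A(x\triangleright b)-\Delta_A(b\triangleleft x)=(x\triangleright b_1)\otimes b_2-b_1\otimes(b_2\triangleleft x)+b_1\otimes(x\triangleright b_2)$; $(\mathrm{id}-\tau)\Delta_A(x\triangleright b)=(\mathrm{id}-\tau)\big((x\triangleright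 b_1)\otimes b_2+b_1\otimes(x\triangleright b_2)\big)$; $(\mathrm{id}-\tau)\Delta_A(a\triangleleft y)=(\mathrm{id}-\tau)\big(a_1\otimes(a_2\triangleleft y)\big)$; - (bicomodule algebra) $\phi([a,b])=a_{(-1)}\otimes[a_{(0)},b]+b_{(-1)}\otimes[a,b_{(0)}]$; $\psi([a,b])=ab_{(0)}\otimes b_{(1)}-ba_{(0)}\otimes a_{(1)}$; $\phi(ab)-\tau\psi(ab)=b_{(-1)}\otimes ab_{(0)}+a_{(-1)}\otimes a_{(0)}b-b_{(1)}\otimes ab_{(0)}$. Such an $A$ is a braided left-symmetric bialgebra in ${}^{H}_{H}\mathcal{M}{}^{H}_{H}$ if moreover, for all $a,b\in A$, - $\Delta_A([a,b])=ab_1\otimes b_2+b_1\otimes[a,b_2]-ba_1\otimes a_2-a_1\otimes[b,a_2]+a_{(0)}\otimes(a_{(1)}\triangleright b)+(a\triangleleft b_{(-1)})\otimes b_{(0)}+b_{(0)}\otimes(a\triangleleft b_{(1)})-b_{(0)}\otimes(b_{(1)}\triangleright a)-(b\triangleleft a_{(-1)})\otimes a_{(0)}-a_{(0)}\otimes(b\triangleleft a_{(1)})$; - $(\mathrm{id}-\tau)\Delta_A(ab)=(\mathrm{id}-\tau)\big(a_1\otimes a_2b+ab_1\otimes b_2+b_1\otimes ab_2+a_{(0)}\otimes(a_{(1)}\triangleright b)+(a\triangleleft b_{(-1)})\otimes b_{(0)}+b_{(0)}\otimes(a\triangleleft b_{(1)})\big)$. *)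

(* Defs.v *)
From HB Require Import structures.
From mathcomp Require Import all_boot all_order all_algebra.
From mathcomp Require Import boolp.

Set Implicit Arguments.
Unset Strict Implicit.
Unset Printing Implicit Defensive.

Import GRing.Theory.
Local Open Scope ring_scope.
Local Open Scope quotient_scope.

Notation bilinear f := (bilinear_for *:%R *:%R f).

(** * Tensor product of two arbitrary (possibly infinite-dimensional) spaces

    [tensor U V] is the quotient of the formal finite sums of pairs (lists) by
    the congruence generated by the bilinearity relations.  A scalar
    coefficient of a pure tensor is absorbed in its left factor. *)

Inductive tens_rel (K : fieldType) (U V : lmodType K) :
    seq (U * V) -> seq (U * V) -> Prop :=
| tens_refl s : tens_rel s s
| tens_sym s t : tens_rel s t -> tens_rel t s
| tens_trans s t r : tens_rel s t -> tens_rel t r -> tens_rel s r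
| tens_cat s s' t t' :
    tens_rel s s' -> tens_rel t t' -> tens_rel (s ++ t) (s' ++ t')
| tens_catC s t : tens_rel (s ++ t) (t ++ s)
| tens_zero v : tens_rel [:: (0, v)] [::]
| tens_addl u u' v : tens_rel [:: (u + u', v)] [:: (u, v); (u', v)]
| tens_addr u v v' : tens_rel [:: (u, v + v')] [:: (u, v); (u, v')]
| tens_scale k u v : tens_rel [:: (k *: u, v)] [:: (u, k *: v)].

Section TensorProduct.
Variables (K : fieldType) (U V : lmodType K).

Definition tens_relb (s t : seq (U * V)) : bool := `[< tens_rel s t >].

Lemma tens_relb_refl : reflexive tens_relb.
Proof. by move=> s; apply/asboolP; apply: tens_refl. Qed.

Lemma tens_relb_sym : symmetric tens_relb.
Proof. by move=> s t; apply/asboolP/asboolP; apply: tens_sym. Qed.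

Lemma tens_relb_trans : transitive tens_relb.
Proof.
move=> t s r /asboolP h1 /asboolP h2; apply/asboolP; exact: tens_trans h1 h2.
Qed.

Canonical tens_equiv :=
  EquivRel tens_relb tens_relb_refl tens_relb_sym tens_relb_trans.

Definition tensor : Type := {eq_quot tens_equiv}.
HB.instance Definition _ := Choice.on tensor.
HB.instance Definition _ := EqQuotient.on tensor.

Definition tens (u : U) (v : V) : tensor := \pi_tensor [:: (u, v)].

Lemma tens_eqP (s t : seq (U * V)) :
  (\pi_tensor s = \pi_tensor t) <-> tens_rel s t.
Proof.
split=> [/eqP|h]; last by apply/eqP; rewrite eqmodE /=; apply/asboolP.
by rewrite eqmodE /= => /asboolP.
Qed.

Lemma tens_repr (s : seq (U * V)) : tens_rel (repr (\pi_tensor s)) s.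
Proof. by apply/tens_eqP; rewrite reprK. Qed.

Lemma tens_zero_r u : tens_rel [:: (u, 0)] ([::] : seq (U * V)).
Proof.
rewrite -(scale0r (0 : V)).
apply: tens_trans (tens_sym (tens_scale _ _ _)) _.
by rewrite scale0r; apply: tens_zero.
Qed.

Let scale_seq (k : K) (s : seq (U * V)) := [seq (k *: p.1, p.2) | p <- s].

Let scale_seq_rel k s t :
  tens_rel s t -> tens_rel (scale_seq k s) (scale_seq k t).
Proof.
elim=> {s t} [s|s t _ h|s t r _ h1 _ h2|s s' t t' _ h1 _ h2|s t|v|u u' v|u v v'
  |c u v]; rewrite /scale_seq ?map_cat /=.
- exact: tens_refl.
- exact: tens_sym.
- exact: tens_trans h1 h2.
- exact: tens_cat.
- exact: tens_catC.
- by rewrite scaler0; apply: tens_zero.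
- by rewrite scalerDr; apply: tens_addl.
- exact: tens_addr.
- by rewrite scalerA mulrC -scalerA; apply: tens_scale.
Qed.

Definition tens0 : tensor := \pi_tensor [::].
Definition tens_add (x y : tensor) : tensor := \pi_tensor (repr x ++ repr y).
Definition tens_scaler (k : K) (x : tensor) : tensor :=
  \pi_tensor [seq (k *: p.1, p.2) | p <- repr x].
Definition tens_opp (x : tensor) : tensor := tens_scaler (-1) x.

Let addE s t : tens_add (\pi s) (\pi t) = \pi_tensor (s ++ t).
Proof. by apply/tens_eqP; apply: tens_cat; apply: tens_repr. Qed.

Let scaleE k s : tens_scaler k (\pi s) = \pi_tensor (scale_seq k s).
Proof. by apply/tens_eqP; apply: scale_seq_rel; apply: tens_repr. Qed.

Let addA : associative tens_add.
Proof.
by elim/quotW=> x; elim/quotW=> y; elim/quotW=> z; rewrite !addE catA.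
Qed.

Let addC : commutative tens_add.
Proof.
elim/quotW=> x; elim/quotW=> y; rewrite !addE; apply/tens_eqP.
exact: tens_catC.
Qed.

Let add0 : left_id tens0 tens_add.
Proof. by elim/quotW=> x; rewrite addE. Qed.

Let scalerDl_ x : {morph tens_scaler^~ x : a b / a + b >-> tens_add a b}.
Proof.
move=> a b; elim/quotW: x => s; rewrite !scaleE addE; apply/tens_eqP.
elim: s => [|p s ih]; first exact: tens_refl.
rewrite /= -cat1s.
apply: tens_trans (tens_cat (_ : tens_rel _ [:: (a *: p.1, p.2); (b *: p.1, p.2)])
  ih) _; first by rewrite scalerDl; apply: tens_addl.
set sa := scale_seq a s; set sb := scale_seq b s.
change (tens_rel ([:: (a *: p.1, p.2)] ++ (([:: (b *: p.1, p.2)] ++ sa) ++ sb))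
  ([:: (a *: p.1, p.2)] ++ (sa ++ ([:: (b *: p.1, p.2)] ++ sb)))).
apply: tens_cat; first exact: tens_refl.
rewrite [X in tens_rel _ X]catA; apply: tens_cat; last exact: tens_refl.
exact: tens_catC.
Qed.

Let scale0 x : tens_scaler 0 x = tens0.
Proof.
elim/quotW: x => s; rewrite scaleE; apply/tens_eqP.
elim: s => [|p s ih]; first exact: tens_refl.
rewrite /= -cat1s -[X in tens_rel _ X]cats0.
by apply: tens_cat ih; rewrite scale0r; apply: tens_zero.
Qed.

Let scale1 : left_id 1 tens_scaler.
Proof.
elim/quotW=> s; rewrite scaleE /scale_seq; congr (\pi _).
by rewrite -[RHS]map_id; apply: eq_map => -[u v] /=; rewrite scale1r.
Qed.

Let addN : left_inverse tens0 tens_opp tens_add.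
Proof.
by move=> x; rewrite -[X in tens_add _ X]scale1 /tens_opp -scalerDl_ addNr scale0.
Qed.

HB.instance Definition _ := GRing.isZmodule.Build tensor addA addC add0 addN.

Let scaleA a b x : tens_scaler a (tens_scaler b x) = tens_scaler (a * b) x.
Proof.
elim/quotW: x => s; rewrite !scaleE /scale_seq -map_comp; congr (\pi _).
by apply: eq_map => p /=; rewrite scalerA.
Qed.

Let scaleDr : right_distributive tens_scaler +%R.
Proof.
move=> k; elim/quotW=> s; elim/quotW=> t.
rewrite [_ + _]addE !scaleE [RHS]addE.
by rewrite /scale_seq map_cat.
Qed.

HB.instance Definition _ := GRing.Zmodule_isLmodule.Build K tensor
  scaleA scale1 scaleDr scalerDl_.

Lemma tens_bilinear : bilinear tens.
Proof.
have addtE s t : \pi_tensor s + \pi_tensor t = \pi_tensor (s ++ t) := addE s t.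
have scaletE k u v : k *: tens u v = \pi_tensor [:: (k *: u, v)] := scaleE _ _.
split=> [v k u u'|u k v v'] /=; rewrite scaletE addtE; apply/tens_eqP.
  exact: tens_addl.
apply: tens_trans (tens_addr _ _ _) _.
apply: (@tens_cat _ _ _ [:: (u, k *: v)] [:: (k *: u, v)] [:: (u, v')] [:: (u, v')]).
  by apply: tens_sym; apply: tens_scale.
exact: tens_refl.
Qed.

Lemma tensDl u u' v : tens (u + u') v = tens u v + tens u' v.
Proof. by have /= := tens_bilinear.1 v 1 u u'; rewrite !scale1r. Qed.

Lemma tensDr u v v' : tens u (v + v') = tens u v + tens u v'.
Proof. by have /= := tens_bilinear.2 u 1 v v'; rewrite !scale1r. Qed.

Lemma tens0l v : tens 0 v = 0.
Proof. apply/tens_eqP; exact: tens_zero. Qed.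

Lemma tens0r u : tens u 0 = 0.
Proof. apply/tens_eqP; exact: tens_zero_r. Qed.

Lemma tensZl k u v : tens (k *: u) v = k *: tens u v.
Proof. by have /= := tens_bilinear.1 v k u 0; rewrite tens0l !addr0. Qed.

Lemma tensZr k u v : tens u (k *: v) = k *: tens u v.
Proof. by have /= := tens_bilinear.2 u k v 0; rewrite tens0r !addr0. Qed.

Lemma tens_sumE (x : tensor) : x = \sum_(p <- repr x) tens p.1 p.2.
Proof.
rewrite -[LHS]reprK; elim: (repr x) => [|[u v] s ih].
  by rewrite big_nil.
by rewrite big_cons -ih; rewrite -cat1s; exact/esym/addE.
Qed.

Lemma tens_ind (P : tensor -> Prop) :
  P 0 -> (forall u v x, P x -> P (tens u v + x)) -> forall x, P x.
Proof.
move=> P0 PD x; rewrite [x]tens_sumE.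
by elim: (repr x) => [|p s ih]; rewrite ?big_nil ?big_cons //; apply: PD.
Qed.

(** Sweedler sums: if [x] is the sum of the [u_i ⊗ v_i], then [tsum x f] is the
    sum of the [f u_i v_i].  For bilinear [f] (the only use made of it) this does
    not depend on the decomposition of [x], by [tsum_tens] and [tsum_linear]. *)
Definition tsum (W : lmodType K) (x : tensor) (f : U -> V -> W) : W :=
  \sum_(p <- repr x) f p.1 p.2.

Lemma tens_rel_sum (W : lmodType K) (f : U -> V -> W) s t :
  bilinear f -> tens_rel s t ->
  \sum_(p <- s) f p.1 p.2 = \sum_(p <- t) f p.1 p.2.
Proof.
move=> [fl fr].
have fDl u u' v : f (u + u') v = f u v + f u' v.
  by have /= := fl v 1 u u'; rewrite !scale1r.
have fDr u v v' : f u (v + v') = f u v + f u v'.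
  by have /= := fr u 1 v v'; rewrite !scale1r.
have f0l v : f 0 v = 0.
  by apply: (addrI (f 0 v)); rewrite -fDl !addr0.
have f0r u : f u 0 = 0.
  by apply: (addrI (f u 0)); rewrite -fDr !addr0.
elim=> {s t} [s|s t _ h|s t r _ h1 _ h2|s s' t t' _ h1 _ h2|s t|v|u u' v|u v v'
  |k u v] //; rewrite ?big_cat /= ?big_cons ?big_nil ?addr0 //.
- by rewrite h1.
- by rewrite h1 h2.
- by rewrite addrC.
- exact: fDl.
- exact: fDr.
- rewrite /=; have /= := fl v k u 0; have /= := fr u k v 0.
  by rewrite !addr0 f0l f0r !addr0 => -> ->.
Qed.

Lemma tsum_tens (W : lmodType K) (f : U -> V -> W) u v :
  bilinear f -> tsum (tens u v) f = f u v.
Proof.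
move=> fB; rewrite /tsum (tens_rel_sum fB (tens_repr _)).
by rewrite big_cons big_nil addr0.
Qed.

Lemma tsum_linear (W : lmodType K) (f : U -> V -> W) :
  bilinear f -> linear (fun x => tsum x f).
Proof.
move=> fB k; elim/quotW=> s; elim/quotW=> t.
rewrite [_ *: _]scaleE [_ + _]addE /tsum.
rewrite !(tens_rel_sum fB (tens_repr _)) big_cat /=; congr (_ + _).
rewrite big_map scaler_sumr; apply: eq_bigr => -[u v] _ /=.
have [fl fr] := fB.
have f0 : f 0 v = 0.
  by have /= := fl v 1 0 0; rewrite !scale1r addr0 -{1}[f 0 v]addr0 => /addrI.
by have /= := fl v k u 0; rewrite addr0 f0 addr0.
Qed.

End TensorProduct.

Notation "U ⊗ V" := (tensor U V)
  (at level 40, left associativity) : type_scope.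
Notation "u ⊗ v" := (tens u v)
  (at level 40, left associativity) : ring_scope.
Notation "\tsum_ ( a , b <- x ) F" := (tsum x (fun a b => F))
  (at level 41, a name, b name, x at level 60, F at level 41,
   format "'[' \tsum_ ( a ,  b  <-  x ) '/  '  F ']'") : ring_scope.

Definition tmap (K : fieldType) (U U' V V' : lmodType K)
    (f : U -> U') (g : V -> V') (x : (U ⊗ V)%type) : (U' ⊗ V')%type :=
  \tsum_(u, v <- x) f u ⊗ g v.

Definition tau (K : fieldType) (U V : lmodType K) (x : (U ⊗ V)%type) :
    (V ⊗ U)%type := \tsum_(u, v <- x) v ⊗ u.

(** Triple tensor products are read as [(U ⊗ V) ⊗ W]; [tassoc] is the canonical
    identification of [U ⊗ (V ⊗ W)] with it. *)
Definition tassoc (K : fieldType) (U V W : lmodType K)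
    (x : (U ⊗ (V ⊗ W))%type) : (U ⊗ V ⊗ W)%type :=
  \tsum_(u, y <- x) \tsum_(v, w <- y) (u ⊗ v ⊗ w).

Definition tau12 (K : fieldType) (U V W : lmodType K)
    (x : (U ⊗ V ⊗ W)%type) : (V ⊗ U ⊗ W)%type :=
  \tsum_(y, w <- x) tau y ⊗ w.

Definition idmtau (K : fieldType) (U : lmodType K) (x : (U ⊗ U)%type) :
    (U ⊗ U)%type := x - tau x.

Definition comm (K : fieldType) (U : lmodType K) (mul : U -> U -> U) (a b : U)
    : U := mul a b - mul b a.

Record ls_algebra (K : fieldType) (A : lmodType K) (mul : A -> A -> A) : Prop :=
  LSAlgebra {
    ls_mul_bilinear : bilinear mul;
    ls_mul_lsym : forall a b c,
      mul (mul a b) c - mul a (mul b c) = mul (mul b a) c - mul b (mul a c) }.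

Record ls_coalgebra (K : fieldType) (C : lmodType K) (D : C -> (C ⊗ C)%type)
    : Prop := LSCoalgebra {
  ls_comul_linear : linear D;
  ls_comul_lsym : forall c,
    let X := (\tsum_(c1, c2 <- D c) (D c1 ⊗ c2))
             - tassoc (\tsum_(c1, c2 <- D c) (c1 ⊗ D c2)) in
    tau12 X = X }.

Record ls_bialgebra (K : fieldType) (A : lmodType K)
    (mul : A -> A -> A) (D : A -> (A ⊗ A)%type) : Prop := LSBialgebra {
  lsb_algebra : ls_algebra mul;
  lsb_coalgebra : ls_coalgebra D;
  lsb_comul_comm : forall a b,
    D (comm mul a b) =
      (\tsum_(b1, b2 <- D b) mul a b1 ⊗ b2)
      + (\tsum_(b1, b2 <- D b) b1 ⊗ comm mul a b2)
      - (\tsum_(a1, a2 <- D a) mul b a1 ⊗ a2)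
      - (\tsum_(a1, a2 <- D a) a1 ⊗ comm mul b a2);
  lsb_comul_mul : forall a b,
    idmtau (D (mul a b)) = idmtau (
      (\tsum_(a1, a2 <- D a) a1 ⊗ mul a2 b)
      + (\tsum_(b1, b2 <- D b) mul a b1 ⊗ b2)
      + (\tsum_(b1, b2 <- D b) b1 ⊗ mul a b2)) }.

(** In the following structures [l x v] is [x ▷ v] and [r v x] is [v ◁ x]. *)

Record ls_bimodule (K : fieldType) (H V : lmodType K) (mul : H -> H -> H)
    (l : H -> V -> V) (r : V -> H -> V) : Prop := LSBimodule {
  lsm_l_bilinear : bilinear l;
  lsm_r_bilinear : bilinear r;
  lsm_left : forall x y v,
    l (mul x y) v - l x (l y v) = l (mul y x) v - l y (l x v);
  lsm_right : forall x y v,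
    r (r v x) y - r v (mul x y) = r (l x v) y - l x (r v y) }.

Record ls_bicomodule (K : fieldType) (H V : lmodType K) (D : H -> (H ⊗ H)%type)
    (phi : V -> (H ⊗ V)%type) (psi : V -> (V ⊗ H)%type) : Prop :=
  LSBicomodule {
    lsc_phi_linear : linear phi;
    lsc_psi_linear : linear psi;
    lsc_left : forall v,
      let X := (\tsum_(h, w <- phi v) D h ⊗ w)
               - tassoc (\tsum_(h, w <- phi v) h ⊗ phi w) in
      tau12 X = X;
    lsc_right : forall v,
      (\tsum_(w, h <- psi v) psi w ⊗ h)
      - tassoc (\tsum_(w, h <- psi v) w ⊗ D h)
      = tau12 ((\tsum_(w, h <- psi v) phi w ⊗ h)
               - tassoc (\tsum_(h, w <- phi v) h ⊗ psi w)) }.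

Record ls_hopf_bimodule (K : fieldType) (H V : lmodType K)
    (mul : H -> H -> H) (D : H -> (H ⊗ H)%type)
    (l : H -> V -> V) (r : V -> H -> V)
    (phi : V -> (H ⊗ V)%type) (psi : V -> (V ⊗ H)%type) : Prop :=
  LSHopfBimodule {
    lsh_bimodule : ls_bimodule mul l r;
    lsh_bicomodule : ls_bicomodule D phi psi;
    lsh_phi_comm : forall x v,
      phi (r v x) - phi (l x v) =
        (\tsum_(h, w <- phi v) h ⊗ r w x)
        + (\tsum_(x1, x2 <- D x) x1 ⊗ r v x2)
        - (\tsum_(x1, x2 <- D x) x1 ⊗ l x2 v)
        - (\tsum_(h, w <- phi v) mul x h ⊗ w)
        - (\tsum_(h, w <- phi v) h ⊗ l x w);
    lsh_psi_comm : forall x v,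
      psi (l x v) - psi (r v x) =
        (\tsum_(w, h <- psi v) l x w ⊗ h)
        + (\tsum_(w, h <- psi v) w ⊗ comm mul x h)
        - (\tsum_(x1, x2 <- D x) r v x1 ⊗ x2);
    lsh_left : forall x v,
      phi (l x v) - tau (psi (l x v)) =
        (\tsum_(x1, x2 <- D x) x1 ⊗ l x2 v)
        + (\tsum_(h, w <- phi v) mul x h ⊗ w)
        + (\tsum_(h, w <- phi v) h ⊗ l x w)
        - (\tsum_(w, h <- psi v) h ⊗ l x w)
        - (\tsum_(w, h <- psi v) mul x h ⊗ w);
    lsh_right : forall x v,
      phi (r v x) - tau (psi (r v x)) =
        (\tsum_(h, w <- phi v) h ⊗ r w x)
        + (\tsum_(x1, x2 <- D x) x1 ⊗ r v x2)
        - (\tsum_(w, h <- psi v) mul h x ⊗ w)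
        - (\tsum_(x1, x2 <- D x) x2 ⊗ r v x1) }.

(** [A] is a left-symmetric algebra and a left-symmetric coalgebra in the
    category of left-symmetric Hopf bimodules over [H]. *)
Record ls_algebra_coalgebra_in (K : fieldType) (H A : lmodType K)
    (mulH : H -> H -> H) (DH : H -> (H ⊗ H)%type)
    (mul : A -> A -> A) (D : A -> (A ⊗ A)%type)
    (l : H -> A -> A) (r : A -> H -> A)
    (phi : A -> (H ⊗ A)%type) (psi : A -> (A ⊗ H)%type) : Prop :=
  LSAlgebraCoalgebraIn {
    lsi_algebra : ls_algebra mul;
    lsi_coalgebra : ls_coalgebra D;
    lsi_hopf_bimodule : ls_hopf_bimodule mulH DH l r phi psi;
    lsi_modalg_left : forall x a b,
      l x (mul a b) - mul (l x a) b = mul a (l x b) - mul (r a x) b;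
    lsi_modalg_right : forall x a b,
      r (mul a b) x - mul a (r b x) = r (mul b a) x - mul b (r a x);
    lsi_comodcoalg_left : forall a,
      tassoc (\tsum_(h, a0 <- phi a) h ⊗ D a0)
      - (\tsum_(a1, a2 <- D a) phi a1 ⊗ a2)
      = tau12 (tassoc (\tsum_(a1, a2 <- D a) a1 ⊗ phi a2)
               - (\tsum_(a1, a2 <- D a) psi a1 ⊗ a2));
    lsi_comodcoalg_right : forall a,
      let X := (\tsum_(a0, h <- psi a) D a0 ⊗ h)
               - tassoc (\tsum_(a1, a2 <- D a) a1 ⊗ psi a2) in
      tau12 X = X;
    lsi_modcoalg_comm : forall x b,
      D (l x b) - D (r b x) =
        (\tsum_(b1, b2 <- D b) l x b1 ⊗ b2)
        - (\tsum_(b1, b2 <- D b) b1 ⊗ r b2 x)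
        + (\tsum_(b1, b2 <- D b) b1 ⊗ l x b2);
    lsi_modcoalg_left : forall x b,
      idmtau (D (l x b)) = idmtau (
        (\tsum_(b1, b2 <- D b) l x b1 ⊗ b2)
        + (\tsum_(b1, b2 <- D b) b1 ⊗ l x b2));
    lsi_modcoalg_right : forall a y,
      idmtau (D (r a y)) = idmtau (\tsum_(a1, a2 <- D a) a1 ⊗ r a2 y);
    lsi_comodalg_phi : forall a b,
      phi (comm mul a b) =
        (\tsum_(h, a0 <- phi a) h ⊗ comm mul a0 b)
        + (\tsum_(h, b0 <- phi b) h ⊗ comm mul a b0);
    lsi_comodalg_psi : forall a b,
      psi (comm mul a b) =
        (\tsum_(b0, h <- psi b) mul a b0 ⊗ h)
        - (\tsum_(a0, h <- psi a) mul b a0 ⊗ h);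
    lsi_comodalg_mul : forall a b,
      phi (mul a b) - tau (psi (mul a b)) =
        (\tsum_(h, b0 <- phi b) h ⊗ mul a b0)
        + (\tsum_(h, a0 <- phi a) h ⊗ mul a0 b)
        - (\tsum_(b0, h <- psi b) h ⊗ mul a b0) }.

Record braided_ls_bialgebra (K : fieldType) (H A : lmodType K)
    (mulH : H -> H -> H) (DH : H -> (H ⊗ H)%type)
    (mul : A -> A -> A) (D : A -> (A ⊗ A)%type)
    (l : H -> A -> A) (r : A -> H -> A)
    (phi : A -> (H ⊗ A)%type) (psi : A -> (A ⊗ H)%type) : Prop :=
  BraidedLSBialgebra {
    brd_in : ls_algebra_coalgebra_in mulH DH mul D l r phi psi;
    brd_comul_comm : forall a b,
      D (comm mul a b) =
        (\tsum_(b1, b2 <- D b) mul a b1 ⊗ b2)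
        + (\tsum_(b1, b2 <- D b) b1 ⊗ comm mul a b2)
        - (\tsum_(a1, a2 <- D a) mul b a1 ⊗ a2)
        - (\tsum_(a1, a2 <- D a) a1 ⊗ comm mul b a2)
        + (\tsum_(a0, h <- psi a) a0 ⊗ l h b)
        + (\tsum_(h, b0 <- phi b) r a h ⊗ b0)
        + (\tsum_(b0, h <- psi b) b0 ⊗ r a h)
        - (\tsum_(b0, h <- psi b) b0 ⊗ l h a)
        - (\tsum_(h, a0 <- phi a) r b h ⊗ a0)
        - (\tsum_(a0, h <- psi a) a0 ⊗ r b h);
    brd_comul_mul : forall a b,
      idmtau (D (mul a b)) = idmtau (
        (\tsum_(a1, a2 <- D a) a1 ⊗ mul a2 b)
        + (\tsum_(b1, b2 <- D b) mul a b1 ⊗ b2)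
        + (\tsum_(b1, b2 <- D b) b1 ⊗ mul a b2)
        + (\tsum_(a0, h <- psi a) a0 ⊗ l h b)
        + (\tsum_(h, b0 <- phi b) r a h ⊗ b0)
        + (\tsum_(b0, h <- psi b) b0 ⊗ r a h)) }.

Definition biprod_mul (K : fieldType) (H A : lmodType K)
    (mulH : H -> H -> H) (mulA : A -> A -> A)
    (l : H -> A -> A) (r : A -> H -> A) (e f : (A * H)%type) : (A * H)%type :=
  (mulA e.1 f.1 + l e.2 f.1 + r e.1 f.2, mulH e.2 f.2).

Definition inA (K : fieldType) (H A : lmodType K) (a : A) : (A * H)%type :=
  (a, 0).

Definition inH (K : fieldType) (H A : lmodType K) (x : H) : (A * H)%type :=
  (0, x).

Definition biprod_comul (K : fieldType) (H A : lmodType K)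
    (DH : H -> (H ⊗ H)%type) (DA : A -> (A ⊗ A)%type)
    (phi : A -> (H ⊗ A)%type) (psi : A -> (A ⊗ H)%type) (e : (A * H)%type) :
    ((A * H) ⊗ (A * H))%type :=
  tmap (@inA K H A) (@inA K H A) (DA e.1)
  + tmap (@inH K H A) (@inA K H A) (phi e.1)
  + tmap (@inA K H A) (@inH K H A) (psi e.1)
  + tmap (@inH K H A) (@inH K H A) (DH e.2).

(* Main.v *)
Require Import Defs.
From mathcomp Require Import all_boot all_order all_algebra.
From mathcomp Require Import boolp.

Set Implicit Arguments.
Unset Strict Implicit.
Unset Printing Implicit Defensive.

Import GRing.Theory.
Local Open Scope ring_scope.
Local Notation bilinear f := (bilinear_for *:%R *:%R f).

(** Everything about [E = A ⊕ H] can be checked one summand at a time: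
    [E ⊗ E] is the sum of the four blocks [A ⊗ A], [H ⊗ A], [A ⊗ H], [H ⊗ H], and [E ⊗ E ⊗ E] is the sum of
    eight.  By multilinearity the arguments may be taken in [A] or in [H], and
    then each block of each identity is one of the axioms:

    - left symmetry of the product of [E] is left symmetry of [A] and of [H],
      the two bimodule axioms, and the two bimodule algebra axioms
      ([biprod_mul_lsym]);
    - left cosymmetry is, block by block, left cosymmetry of [A] and of [H], the
      two bicomodule axioms and the two bicomodule coalgebra axioms
      ([coassoc_defect_A], [biprod_ls_coalgebra]);
    - each of the two compatibilities between product and coproduct is rephrased
      as the vanishing of a biadditive defect on [E].  On [H, H] it vanishes
      because [H] is a bialgebra; on mixed arguments its blocks are the four
      Hopf bimodule axioms and the three bimodule coalgebra axioms.  On [A, A]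
      the blocks [H ⊗ A] and [A ⊗ H] vanish by the bicomodule algebra axioms,
      and the block [A ⊗ A] is exactly the defect of the corresponding braided
      compatibility ([cocycle_defect_AA], [leibniz_defect_AA]).

    Hence [E] is always a left-symmetric algebra and coalgebra, and since
    [A ⊗ A] embeds in [E ⊗ E] ([block_AA_inj]), the defects on [E] vanish if and
    only if the braided defects on [A] do ([biprod_cocycleP],
    [biprod_leibnizP]). *)

(** * Identities in abelian groups *)

Lemma subr_eq0_pad (V : zmodType) (x y : V) : x - y + 0 = 0 -> x = y.
Proof. by rewrite addr0 => /subr0_eq. Qed.

(** Everything is moved to the left-hand side; then the head summand travels to
    the right until it meets its opposite.  The trailing zero left by
    [subr_eq0_pad] gives the last summand a right neighbour, so that the final
    cancellation is not a special case. *)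
Ltac sink x :=
  first [ rewrite [x + (- x + _)]addNKr | rewrite [x + (_ + _)]addrCA; sink x ].
Ltac sinkN x :=
  first [ rewrite [- x + (x + _)]addKr | rewrite [- x + (_ + _)]addrCA; sinkN x ].
Ltac abel :=
  apply: subr_eq0_pad; rewrite ?(opprD, opprK) -!addrA;
  repeat lazymatch goal with
  | |- - ?x + _ = 0 => sinkN x
  | |- ?x + _ = 0 => sink x
  end; rewrite ?oppr0 ?addr0; reflexivity.

(** * Sweedler calculus *)

Section Linear.
Variables (K : fieldType) (U V : lmodType K) (f : U -> V).
Hypothesis f_lin : linear f.

Lemma lin0 : f 0 = 0.
Proof. by have := f_lin (-1) 0 0; rewrite scaler0 addr0 scaleN1r addNr. Qed.
Lemma linD : {morph f : x y / x + y}.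
Proof. by move=> x y; have := f_lin 1 x y; rewrite !scale1r. Qed.
Lemma linN : {morph f : x / - x}.
Proof.
by move=> x; have := f_lin (-1) x 0; rewrite !addr0 !scaleN1r lin0 addr0.
Qed.
Lemma linB : {morph f : x y / x - y}.
Proof. by move=> x y; rewrite linD linN. Qed.
Lemma lin_sum I (s : seq I) F : f (\sum_(i <- s) F i) = \sum_(i <- s) f (F i).
Proof. exact: (big_morph f linD lin0). Qed.
End Linear.

Section Sweedler.
Variables (K : fieldType).
Implicit Types U V W : lmodType K.

Lemma id_linear U : linear (@idfun U).
Proof. by []. Qed.

Lemma tens_comp_bilinear U U' V V' (f : U -> U') (g : V -> V') :
  linear f -> linear g -> bilinear (fun u v => f u ⊗ g v).
Proof.
by move=> hf hg; split=> [v k u u'|u k v v'] /=;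
  rewrite ?hf ?hg ?tensDl ?tensDr ?tensZl ?tensZr.
Qed.

Lemma tmap_linear U U' V V' (f : U -> U') (g : V -> V') :
  linear f -> linear g -> linear (tmap f g).
Proof. by move=> hf hg; apply: tsum_linear; apply: tens_comp_bilinear. Qed.

Lemma tmap_tens U U' V V' (f : U -> U') (g : V -> V') u v :
  linear f -> linear g -> tmap f g (u ⊗ v) = f u ⊗ g v.
Proof. by move=> hf hg; rewrite /tmap tsum_tens //; apply: tens_comp_bilinear. Qed.

Lemma lin_tsum U V W W' (h : W -> W') (t : (U ⊗ V)%type) F :
  linear h -> h (tsum t F) = tsum t (fun u v => h (F u v)).
Proof. by move=> hh; rewrite /tsum (lin_sum hh). Qed.

Lemma eq_tsum U V W (t : (U ⊗ V)%type) (F G : U -> V -> W) :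
  (forall u v, F u v = G u v) -> tsum t F = tsum t G.
Proof. by move=> FG; apply: eq_bigr. Qed.

(** Only the outer maps need to be linear: the inner ones are applied to the
    entries of one fixed representative of the tensor, which is what lets block
    computations run without linearity of the structure maps involved. *)
Lemma tmap_tmap U U' U'' V V' V'' (f : U' -> U'') (g : V' -> V'')
    (f' : U -> U') (g' : V -> V') t :
  linear f -> linear g -> tmap f g (tmap f' g' t) = tmap (f \o f') (g \o g') t.
Proof.
move=> hf hg; rewrite [tmap f' g' t]/tmap (lin_tsum _ _ (tmap_linear hf hg)).
by apply: eq_tsum => u v; rewrite tmap_tens.
Qed.

Lemma tmap_id U V (t : (U ⊗ V)%type) : tmap id id t = t.
Proof. by rewrite [RHS]tens_sumE. Qed.

Lemma tmapDl U U' V V' (f f' : U -> U') (g : V -> V') t :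
  tmap (f \+ f') g t = tmap f g t + tmap f' g t.
Proof.
by rewrite /tmap /tsum -big_split; apply: eq_bigr => p _ /=; rewrite tensDl.
Qed.

Lemma tmapDr U U' V V' (f : U -> U') (g g' : V -> V') t :
  tmap f (g \+ g') t = tmap f g t + tmap f g' t.
Proof.
by rewrite /tmap /tsum -big_split; apply: eq_bigr => p _ /=; rewrite tensDr.
Qed.

Lemma tmapBr U U' V V' (f : U -> U') (g g' : V -> V') t :
  tmap f (g \- g') t = tmap f g t - tmap f g' t.
Proof.
rewrite /tmap /tsum -sumrB; apply: eq_bigr => p _ /=.
by rewrite tensDr -scaleN1r tensZr scaleN1r.
Qed.

Lemma tau_linear U V : linear (@tau K U V).
Proof.
apply: tsum_linear; split=> [v k u u'|u k v v'] /=;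
  by rewrite ?tensDl ?tensDr ?tensZl ?tensZr.
Qed.

Lemma tau_tens U V (u : U) (v : V) : tau (u ⊗ v) = v ⊗ u.
Proof.
rewrite /tau tsum_tens //; split=> [w k x y|w k x y] /=;
  by rewrite ?tensDl ?tensDr ?tensZl ?tensZr.
Qed.

Lemma tau_tsum U V U' V' (t : (U ⊗ V)%type) (f : U -> V -> U')
    (g : U -> V -> V') :
  tau (\tsum_(u, v <- t) f u v ⊗ g u v) = \tsum_(u, v <- t) g u v ⊗ f u v.
Proof.
rewrite (lin_tsum _ _ (@tau_linear _ _)).
by apply: eq_tsum => u v; rewrite tau_tens.
Qed.

Lemma tau_tmap U U' V V' (f : U -> U') (g : V -> V') t :
  linear f -> linear g -> tau (tmap f g t) = tmap g f (tau t).
Proof.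
move=> hf hg; rewrite {2}/tau (lin_tsum _ _ (tmap_linear hg hf)) tau_tsum.
by apply: eq_tsum => u v; rewrite tmap_tens.
Qed.

Lemma tauK U V : cancel (@tau K U V) (@tau K V U).
Proof. by move=> t; rewrite {2}/tau tau_tsum [RHS]tens_sumE. Qed.

Lemma tau12_linear U V W : linear (@tau12 K U V W).
Proof. exact: (tmap_linear (@tau_linear _ _) (@id_linear _)). Qed.

Lemma tau12K U V W : cancel (@tau12 K U V W) (@tau12 K V U W).
Proof.
move=> t; rewrite -[LHS]/(tmap (@tau _ _ _) id (tmap (@tau _ _ _) id t)).
rewrite tmap_tmap //; last exact: tau_linear.
by rewrite (_ : _ \o _ = id) ?tmap_id //; apply/funext/tauK.
Qed.

Lemma tau12_tmap U U' V V' W W' (f : U -> U') (g : V -> V') (h : W -> W') t :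
  linear f -> linear g -> linear h ->
  tau12 (tmap (tmap f g) h t) = tmap (tmap g f) h (tau12 t).
Proof.
move=> hf hg hh; rewrite -[LHS]/(tmap (@tau _ _ _) id _).
rewrite -[tau12 t]/(tmap (@tau _ _ _) id t).
rewrite !tmap_tmap //; first last.
- exact: tau_linear.
- exact: tmap_linear.
by congr (tmap _ _ t); apply/funext => x /=; rewrite tau_tmap.
Qed.

Let tassoc_bilinear U V W : bilinear (fun u (y : (V ⊗ W)%type) =>
  \tsum_(v, w <- y) ((u : U) ⊗ v ⊗ w)).
Proof.
split=> [y k u u'|u k y y'] /=.
  rewrite /tsum scaler_sumr -big_split; apply: eq_bigr => p _ /=.
  by rewrite tensDl tensZl tensDl tensZl.
apply: tsum_linear.
by split=> [w l v v'|v l w w'] /=; rewrite ?tensDr ?tensZr ?tensDl ?tensZl.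
Qed.

Lemma tassoc_linear U V W : linear (@tassoc K U V W).
Proof. exact/tsum_linear/tassoc_bilinear. Qed.

Lemma tassoc_tens U V W (u : U) (v : V) (w : W) :
  tassoc (u ⊗ (v ⊗ w)) = u ⊗ v ⊗ w.
Proof.
rewrite /tassoc tsum_tens; last exact: tassoc_bilinear.
rewrite tsum_tens //.
by split=> [x l y y'|x l y y'] /=; rewrite ?tensDr ?tensZr ?tensDl ?tensZl.
Qed.

(** Naturality of the associator; unlike the other naturality statements it
    involves two nested tensors, hence the double induction. *)
Lemma tassoc_tmap U U' V V' W W' (f : U -> U') (g : V -> V') (h : W -> W') t :
  linear f -> linear g -> linear h ->
  tassoc (tmap f (tmap g h) t) = tmap (tmap f g) h (tassoc t).
Proof.
move=> hf hg hh.
have hgh := tmap_linear hg hh; have hfg := tmap_linear hf hg.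
have hT := @tassoc_linear.
elim/tens_ind: t => [|u y x ih].
  by rewrite !(lin0 (tmap_linear _ _), lin0 (hT _ _ _)).
rewrite !(linD (tmap_linear _ _), linD (hT _ _ _)) //; congr (_ + _) => //.
rewrite tmap_tens //.
elim/tens_ind: y => [|v w z ihz].
  by rewrite (lin0 hgh) !tens0r !(lin0 (hT _ _ _)) (lin0 (tmap_linear _ _)).
rewrite (linD hgh) !tensDr !(linD (hT _ _ _)) (linD (tmap_linear _ _)) // ihz.
by rewrite !tassoc_tens !tmap_tens // tassoc_tens.
Qed.

End Sweedler.

(** * Defects of the bialgebra compatibilities *)

Section Defects.
Variables (K : fieldType) (C : lmodType K).
Implicit Types (mul : C -> C -> C) (D : C -> (C ⊗ C)%type).

(** The action of the commutator algebra on [C ⊗ C], by left multiplication on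
    the first factor and by commutators on the second.  The first bialgebra
    compatibility says that the coproduct is a 1-cocycle for it. *)
Definition cocycle_action mul a (t : (C ⊗ C)%type) : (C ⊗ C)%type :=
  tmap (mul a) id t + tmap id (comm mul a) t.

Lemma cocycle_actionE mul a t :
  cocycle_action mul a t =
    tmap (mul a) id t + (tmap id (mul a) t - tmap id (mul^~ a) t).
Proof. by rewrite /cocycle_action -tmapBr. Qed.

Definition cocycle_defect mul D a b : (C ⊗ C)%type :=
  D (comm mul a b) - (cocycle_action mul a (D b) - cocycle_action mul b (D a)).

(** The second compatibility says that the coproduct satisfies this Leibniz rule
    modulo symmetric tensors. *)
Definition leibniz_rhs mul D a b : (C ⊗ C)%type :=
  tmap id (mul^~ b) (D a) + tmap (mul a) id (D b) + tmap id (mul a) (D b).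

Definition leibniz_defect mul D a b : (C ⊗ C)%type :=
  idmtau (D (mul a b) - leibniz_rhs mul D a b).

Definition coassoc_defect D c : (C ⊗ C ⊗ C)%type :=
  tmap D id (D c) - tassoc (tmap id D (D c)).

Lemma idmtauD : {morph @idmtau K C : s t / s + t}.
Proof. by move=> s t; rewrite /idmtau (linD (@tau_linear _ _ _)); abel. Qed.

Lemma idmtauN : {morph @idmtau K C : s / - s}.
Proof. by move=> s; rewrite /idmtau (linN (@tau_linear _ _ _)); abel. Qed.

Lemma idmtauB : {morph @idmtau K C : s t / s - t}.
Proof. by move=> s t; rewrite idmtauD idmtauN. Qed.

Lemma cocycleP mul D a b :
  D (comm mul a b) =
      (\tsum_(b1, b2 <- D b) mul a b1 ⊗ b2)
      + (\tsum_(b1, b2 <- D b) b1 ⊗ comm mul a b2)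
      - (\tsum_(a1, a2 <- D a) mul b a1 ⊗ a2)
      - (\tsum_(a1, a2 <- D a) a1 ⊗ comm mul b a2)
  <-> cocycle_defect mul D a b = 0.
Proof.
have -> : forall u v w z : (C ⊗ C)%type, u + v - w - z = (u + v) - (w + z).
  by move=> u v w z; abel.
rewrite /cocycle_defect.
by split=> [->|/subr0_eq]; [exact: subrr|].
Qed.

Lemma leibnizP mul D a b :
  idmtau (D (mul a b)) = idmtau (
      (\tsum_(a1, a2 <- D a) a1 ⊗ mul a2 b)
      + (\tsum_(b1, b2 <- D b) mul a b1 ⊗ b2)
      + (\tsum_(b1, b2 <- D b) b1 ⊗ mul a b2))
  <-> leibniz_defect mul D a b = 0.
Proof.
rewrite /leibniz_defect idmtauB.
by split=> [->|/subr0_eq]; [exact: subrr|].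
Qed.

Section Biadditive.
Variables (mul : C -> C -> C) (D : C -> (C ⊗ C)%type).
Hypotheses (mul_bil : bilinear mul) (D_lin : linear D).

Let mulDl x y z : mul (x + y) z = mul x z + mul y z.
Proof. exact: (linD (mul_bil.1 z)). Qed.
Let mulDr x y z : mul z (x + y) = mul z x + mul z y.
Proof. exact: (linD (mul_bil.2 z)). Qed.

Lemma comm_linear a : linear (comm mul a).
Proof.
move=> k u v; rewrite /comm (mul_bil.2 a) (mul_bil.1 a) scalerBr /=; abel.
Qed.

(** By antisymmetry, additivity in one argument gives additivity in the other,
    and vanishing on [H, A] gives vanishing on [A, H]. *)
Lemma cocycle_defectC a b : cocycle_defect mul D b a = - cocycle_defect mul D a b.
Proof.
rewrite /cocycle_defect (_ : comm mul b a = - comm mul a b).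
  by rewrite (linN D_lin); abel.
by rewrite opprB.
Qed.

Lemma cocycle_defectDl a a' b :
  cocycle_defect mul D (a + a') b =
    cocycle_defect mul D a b + cocycle_defect mul D a' b.
Proof.
have commDl c : comm mul (a + a') c = comm mul a c + comm mul a' c.
  by rewrite /comm mulDl mulDr; abel.
have id_lin := @id_linear K C.
rewrite /cocycle_defect /cocycle_action commDl !(linD D_lin).
rewrite (_ : mul (a + a') = mul a \+ mul a'); last exact/funext.
rewrite (_ : comm mul (a + a') = comm mul a \+ comm mul a'); last exact/funext.
rewrite tmapDl tmapDr.
rewrite (linD (tmap_linear (mul_bil.2 b) id_lin)).
by rewrite (linD (tmap_linear id_lin (comm_linear b))); abel.
Qed.

Lemma cocycle_defectDr a b b' :
  cocycle_defect mul D a (b + b') =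
    cocycle_defect mul D a b + cocycle_defect mul D a b'.
Proof.
rewrite cocycle_defectC cocycle_defectDl.
rewrite 2![cocycle_defect _ _ a _]cocycle_defectC.
exact: opprD.
Qed.

Lemma leibniz_defectDl a a' b :
  leibniz_defect mul D (a + a') b =
    leibniz_defect mul D a b + leibniz_defect mul D a' b.
Proof.
have id_lin := @id_linear K C.
rewrite /leibniz_defect -idmtauD /leibniz_rhs mulDl !(linD D_lin).
rewrite (_ : mul (a + a') = mul a \+ mul a'); last exact/funext.
rewrite tmapDl tmapDr (linD (tmap_linear id_lin (mul_bil.1 b))).
by congr idmtau; abel.
Qed.

Lemma leibniz_defectDr a b b' :
  leibniz_defect mul D a (b + b') =
    leibniz_defect mul D a b + leibniz_defect mul D a b'.
Proof.
have id_lin := @id_linear K C.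
rewrite /leibniz_defect -idmtauD /leibniz_rhs mulDr !(linD D_lin).
rewrite (_ : mul^~ (b + b') = mul^~ b \+ mul^~ b'); last exact/funext.
rewrite tmapDr (linD (tmap_linear id_lin (mul_bil.2 a))).
rewrite (linD (tmap_linear (mul_bil.2 a) id_lin)).
by congr idmtau; abel.
Qed.

Lemma coassoc_defectD c c' :
  coassoc_defect D (c + c') = coassoc_defect D c + coassoc_defect D c'.
Proof.
have id_lin := @id_linear K C.
rewrite /coassoc_defect (linD D_lin) (linD (tmap_linear D_lin id_lin)).
rewrite (linD (tmap_linear id_lin D_lin)) (linD (@tassoc_linear _ _ _ _)); abel.
Qed.

End Biadditive.
End Defects.

(** * Blocks of the tensor square of a direct sum *)

Section Blocks.
Variables (K : fieldType) (H A : lmodType K).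
Local Notation E := (A * H)%type.
Local Notation iA := (@inA K H A).
Local Notation iH := (@inH K H A).

Lemma inA_linear : linear iA.
Proof. by move=> k u v; congr (_, _); rewrite /= scaler0 addr0. Qed.

Lemma inH_linear : linear iH.
Proof. by move=> k u v; congr (_, _); rewrite /= scaler0 addr0. Qed.

Lemma inA_inH (e : E) : e = iA e.1 + iH e.2.
Proof. by case: e => a x; congr (_, _); rewrite /= ?addr0 ?add0r. Qed.

(** This is what allows the braided compatibilities to be read off from those of
    the direct sum. *)
Lemma block_AA_inj : injective (tmap iA iA).
Proof.
have fst_linear : linear (fst : E -> A) by [].
apply: (can_inj (g := tmap fst fst)) => t; rewrite tmap_tmap //.
exact: tmap_id.
Qed.

(** The flip exchanges the two mixed blocks, so both of them carry the same
    information, [t - tau w]; this is the combination [phi - tau psi] that the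
    Hopf bimodule and bicomodule algebra axioms prescribe. *)
Lemma idmtau_blocks s (t : (H ⊗ A)%type) (w : (A ⊗ H)%type) :
  idmtau (tmap iA iA s + tmap iH iA t + tmap iA iH w)
  = tmap iA iA (idmtau s) + tmap iH iA (t - tau w)
    - tmap iA iH (tau (t - tau w)).
Proof.
have [lA lH] := (inA_linear, inH_linear).
rewrite /idmtau !(linD (@tau_linear _ _ _)) !tau_tmap //.
rewrite (linN (@tau_linear _ _ _)) tauK.
by rewrite !(linB (tmap_linear _ _)) //; abel.
Qed.

Lemma idmtau_HH (t : (H ⊗ H)%type) :
  idmtau (tmap iH iH t) = tmap iH iH (idmtau t).
Proof.
have lH := inH_linear.
by rewrite /idmtau tau_tmap // (linB (tmap_linear _ _)).
Qed.

End Blocks.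

(** * The biproduct *)

Section Biproduct.
Variables (K : fieldType) (H A : lmodType K).
Variables (mulH : H -> H -> H) (DH : H -> (H ⊗ H)%type).
Variables (mulA : A -> A -> A) (DA : A -> (A ⊗ A)%type).
Variables (l : H -> A -> A) (r : A -> H -> A).
Variables (phi : A -> (H ⊗ A)%type) (psi : A -> (A ⊗ H)%type).
Hypothesis bialgH : ls_bialgebra mulH DH.
Hypothesis hopfA : ls_algebra_coalgebra_in mulH DH mulA DA l r phi psi.

Local Notation E := (A * H)%type.
Local Notation iA := (@inA K H A).
Local Notation iH := (@inH K H A).
Local Notation mulE := (biprod_mul mulH mulA l r).
Local Notation DE := (biprod_comul DH DA phi psi).
Local Notation AA := (tmap iA iA).
Local Notation HA := (tmap iH iA).
Local Notation AH := (tmap iA iH).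
Local Notation HH := (tmap iH iH).

Let mulH_bil : bilinear mulH := ls_mul_bilinear (lsb_algebra bialgH).
Let mulA_bil : bilinear mulA := ls_mul_bilinear (lsi_algebra hopfA).
Let hopf := lsi_hopf_bimodule hopfA.
Let bimod := lsh_bimodule hopf.
Let bicomod := lsh_bicomodule hopf.
Let l_bil : bilinear l := lsm_l_bilinear bimod.
Let r_bil : bilinear r := lsm_r_bilinear bimod.
Let phi_lin : linear phi := lsc_phi_linear bicomod.
Let psi_lin : linear psi := lsc_psi_linear bicomod.
Let DA_lin : linear DA := ls_comul_linear (lsi_coalgebra hopfA).
Let DH_lin : linear DH := ls_comul_linear (lsb_coalgebra bialgH).
Let lA := @inA_linear K H A.
Let lH := @inH_linear K H A.
Let ltmap := tmap_linear.

Lemma biprod_mul_bilinear : bilinear mulE.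
Proof.
split=> [f k e e'|e k f f']; congr (_, _) => /=.
- rewrite (mulA_bil.1 _) (l_bil.1 _) (r_bil.1 _) /= !scalerDr; abel.
- exact: (mulH_bil.1 _).
- rewrite (mulA_bil.2 _) (l_bil.2 _) (r_bil.2 _) /= !scalerDr; abel.
- exact: (mulH_bil.2 _).
Qed.

Lemma biprod_comul_linear : linear DE.
Proof.
move=> k e f; rewrite /biprod_comul /= DA_lin phi_lin psi_lin DH_lin.
by rewrite !(ltmap _ _) // !scalerDr; abel.
Qed.

Let l0 a : l 0 a = 0. Proof. exact: (lin0 (l_bil.1 a)). Qed.
Let l0r x : l x 0 = 0. Proof. exact: (lin0 (l_bil.2 x)). Qed.
Let r0 a : r a 0 = 0. Proof. exact: (lin0 (r_bil.2 a)). Qed.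
Let r0l x : r 0 x = 0. Proof. exact: (lin0 (r_bil.1 x)). Qed.
Let mA0 a : mulA a 0 = 0. Proof. exact: (lin0 (mulA_bil.2 a)). Qed.
Let m0A a : mulA 0 a = 0. Proof. exact: (lin0 (mulA_bil.1 a)). Qed.
Let mH0 a : mulH a 0 = 0. Proof. exact: (lin0 (mulH_bil.2 a)). Qed.
Let m0H a : mulH 0 a = 0. Proof. exact: (lin0 (mulH_bil.1 a)). Qed.
Let zeros := (l0, l0r, r0, r0l, mA0, m0A, mH0, m0H, addr0, add0r).

Lemma biprod_mul_AA a b : mulE (iA a) (iA b) = iA (mulA a b).
Proof. by congr (_, _); rewrite /= !zeros. Qed.
Lemma biprod_mul_AH a y : mulE (iA a) (iH y) = iA (r a y).
Proof. by congr (_, _); rewrite /= !zeros. Qed.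
Lemma biprod_mul_HA x b : mulE (iH x) (iA b) = iA (l x b).
Proof. by congr (_, _); rewrite /= !zeros. Qed.
Lemma biprod_mul_HH x y : mulE (iH x) (iH y) = iH (mulH x y).
Proof. by congr (_, _); rewrite /= !zeros. Qed.
Let mulE_in :=
  (biprod_mul_AA, biprod_mul_AH, biprod_mul_HA, biprod_mul_HH).

Lemma biprod_comul_inA a : DE (iA a) = AA (DA a) + HA (phi a) + AH (psi a).
Proof. by rewrite /biprod_comul /= (lin0 DH_lin) (lin0 (ltmap lH lH)) addr0. Qed.

Lemma biprod_comul_inH x : DE (iH x) = HH (DH x).
Proof.
rewrite /biprod_comul /= (lin0 DA_lin) (lin0 phi_lin) (lin0 psi_lin).
by rewrite !(lin0 (ltmap _ _)) // !add0r.
Qed.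

Let mulE_lin e : linear (mulE e) := biprod_mul_bilinear.2 e.
Let mulE_linr e : linear (mulE^~ e) := biprod_mul_bilinear.1 e.
Let tmap_l (V W : lmodType K) (f : E -> E) (i : V -> E) (j : W -> E) t :
  linear f -> tmap f id (tmap i j t) = tmap (f \o i) j t.
Proof. by move=> hf; rewrite tmap_tmap. Qed.
Let tmap_r (V W : lmodType K) (f : E -> E) (i : V -> E) (j : W -> E) t :
  linear f -> tmap id f (tmap i j t) = tmap i (f \o j) t.
Proof. by move=> hf; rewrite tmap_tmap. Qed.
Let push_l (V W V' : lmodType K) (f : V' -> V) (i : V -> E) (j : W -> E) t :
  linear i -> linear j -> tmap i j (tmap f id t) = tmap (i \o f) j t.
Proof. by move=> hi hj; rewrite tmap_tmap. Qed.
Let push_r (V W W' : lmodType K) (f : W' -> W) (i : V -> E) (j : W -> E) t :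
  linear i -> linear j -> tmap i j (tmap id f t) = tmap i (j \o f) t.
Proof. by move=> hi hj; rewrite tmap_tmap. Qed.
Let push := (push_l, push_r).

(* Equations between maps rather than pointwise, to rewrite inside [tmap]. *)
Let mulE_comp_AA a : mulE (iA a) \o iA = iA \o mulA a.
Proof. by apply/funext => b /=; rewrite mulE_in. Qed.
Let mulE_comp_AH a : mulE (iA a) \o iH = iA \o r a.
Proof. by apply/funext => b /=; rewrite mulE_in. Qed.
Let mulE_comp_HA x : mulE (iH x) \o iA = iA \o l x.
Proof. by apply/funext => b /=; rewrite mulE_in. Qed.
Let mulE_comp_HH x : mulE (iH x) \o iH = iH \o mulH x.
Proof. by apply/funext => b /=; rewrite mulE_in. Qed.
Let rmulE_comp_AA b : mulE^~ (iA b) \o iA = iA \o mulA^~ b.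
Proof. by apply/funext => a /=; rewrite mulE_in. Qed.
Let rmulE_comp_HA b : mulE^~ (iA b) \o iH = iA \o l^~ b.
Proof. by apply/funext => a /=; rewrite mulE_in. Qed.
Let rmulE_comp_AH y : mulE^~ (iH y) \o iA = iA \o r^~ y.
Proof. by apply/funext => a /=; rewrite mulE_in. Qed.
Let rmulE_comp_HH y : mulE^~ (iH y) \o iH = iH \o mulH^~ y.
Proof. by apply/funext => a /=; rewrite mulE_in. Qed.
Let mulE_comp := (mulE_comp_AA, mulE_comp_AH, mulE_comp_HA, mulE_comp_HH,
  rmulE_comp_AA, rmulE_comp_AH, rmulE_comp_HA, rmulE_comp_HH).

(** Normal form of an element of [E ⊗ E]: a sum of terms [tmap (i \o f) (j \o g) t]
    with [i], [j] among the two injections and [t] a coproduct or coaction. *)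
Ltac blocks :=
  rewrite ?(biprod_comul_inA, biprod_comul_inH)
    ?(linD (ltmap _ _), linN (ltmap _ _)) // ?tmap_l // ?tmap_r // ?mulE_comp ?push //.

(** ** The Leibniz rule *)

Lemma leibniz_rhs_AA a b :
  leibniz_rhs mulE DE (iA a) (iA b) =
    AA (leibniz_rhs mulA DA a b + tmap id (l^~ b) (psi a) + tmap (r a) id (phi b)
        + tmap id (r a) (psi b))
    + HA (tmap id (mulA^~ b) (phi a) + tmap id (mulA a) (phi b))
    + AH (tmap (mulA a) id (psi b)).
Proof. by rewrite /leibniz_rhs; blocks; abel. Qed.

Lemma leibniz_rhs_HA x b :
  leibniz_rhs mulE DE (iH x) (iA b) =
    AA (tmap (l x) id (DA b) + tmap id (l x) (DA b))
    + HA (tmap id (l^~ b) (DH x) + tmap (mulH x) id (phi b)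
          + tmap id (l x) (phi b))
    + AH (tmap (l x) id (psi b) + tmap id (mulH x) (psi b)).
Proof. by rewrite /leibniz_rhs; blocks; abel. Qed.

Lemma leibniz_rhs_AH a y :
  leibniz_rhs mulE DE (iA a) (iH y) =
    AA (tmap id (r^~ y) (DA a))
    + HA (tmap id (r^~ y) (phi a) + tmap id (r a) (DH y))
    + AH (tmap id (mulH^~ y) (psi a) + tmap (r a) id (DH y)).
Proof. by rewrite /leibniz_rhs; blocks; abel. Qed.

Lemma leibniz_rhs_HH x y :
  leibniz_rhs mulE DE (iH x) (iH y) = HH (leibniz_rhs mulH DH x y).
Proof. by rewrite /leibniz_rhs; blocks; abel. Qed.

Definition braided_leibniz_defect a b :=
  idmtau (DA (mulA a b) - (leibniz_rhs mulA DA a b + tmap id (l^~ b) (psi a)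
    + tmap (r a) id (phi b) + tmap id (r a) (psi b))).

Definition braided_cocycle_defect a b :=
  cocycle_defect mulA DA a b
  - (tmap id (l^~ b) (psi a) + tmap (r a) id (phi b) + tmap id (r a) (psi b)
     - tmap id (l^~ a) (psi b) - tmap (r b) id (phi a) - tmap id (r b) (psi a)).

(** When the mixed blocks of two tensors agree up to the flip, their difference
    modulo symmetric tensors is concentrated in [A ⊗ A]. *)
Lemma leibniz_defect_blocks s (t : (H ⊗ A)%type) (w : (A ⊗ H)%type) s' t' w' :
  t - tau w = t' - tau w' ->
  idmtau ((AA s + HA t + AH w) - (AA s' + HA t' + AH w')) = AA (idmtau (s - s')).
Proof.
move=> tw; rewrite idmtauB !idmtau_blocks tw.
rewrite [idmtau (s - s')]idmtauB [RHS](linB (ltmap lA lA)); abel.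
Qed.

(** The mixed blocks cancel by the bicomodule algebra axiom for
    [phi (ab) - tau (psi (ab))].  In the block [A ⊗ A] the coactions [psi a],
    [phi b], [psi b] contribute wherever multiplying their [H]-leg by [a] or [b]
    lands in [A]: these are the extra terms of the braided Leibniz rule. *)
Lemma leibniz_defect_AA a b :
  leibniz_defect mulE DE (iA a) (iA b) = AA (braided_leibniz_defect a b).
Proof.
rewrite /leibniz_defect mulE_in biprod_comul_inA leibniz_rhs_AA
  leibniz_defect_blocks //.
by rewrite (lsi_comodalg_mul hopfA) /tmap tau_tsum /=; abel.
Qed.

(** The block [A ⊗ A] vanishes by a bimodule coalgebra axiom, the mixed blocks by
    a Hopf bimodule axiom; likewise with the arguments exchanged. *)
Lemma leibniz_defect_HA x b : leibniz_defect mulE DE (iH x) (iA b) = 0.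
Proof.
rewrite /leibniz_defect mulE_in biprod_comul_inA leibniz_rhs_HA
  leibniz_defect_blocks.
  rewrite idmtauB (lsi_modcoalg_left hopfA) subrr.
  exact: lin0 (ltmap lA lA).
rewrite (lsh_left hopf) (linD (@tau_linear _ _ _)).
by rewrite /tmap !tau_tsum /=; abel.
Qed.

Lemma leibniz_defect_AH a y : leibniz_defect mulE DE (iA a) (iH y) = 0.
Proof.
rewrite /leibniz_defect mulE_in biprod_comul_inA leibniz_rhs_AH
  leibniz_defect_blocks.
  rewrite idmtauB (lsi_modcoalg_right hopfA) subrr.
  exact: lin0 (ltmap lA lA).
rewrite (lsh_right hopf) (linD (@tau_linear _ _ _)).
by rewrite /tmap !tau_tsum /=; abel.
Qed.

Lemma leibniz_defect_HH x y : leibniz_defect mulE DE (iH x) (iH y) = 0.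
Proof.
rewrite /leibniz_defect mulE_in biprod_comul_inH leibniz_rhs_HH.
rewrite -(linB (ltmap lH lH)) idmtau_HH.
rewrite -/(leibniz_defect mulH DH x y) (leibnizP _ _ _ _).1.
  exact: lin0 (ltmap lH lH).
exact: lsb_comul_mul bialgH _ _.
Qed.

(** ** The cocycle condition *)

(** The blocks [H ⊗ A] and [A ⊗ H] are the bicomodule algebra axioms for
    [phi [a, b]] and [psi [a, b]]. *)
Lemma cocycle_defect_AA a b :
  cocycle_defect mulE DE (iA a) (iA b) = AA (braided_cocycle_defect a b).
Proof.
rewrite /cocycle_defect.
have -> : comm mulE (iA a) (iA b) = iA (comm mulA a b).
  by rewrite /comm !mulE_in (linB lA).
have phiE : phi (comm mulA a b) =
  tmap id (mulA^~ b \- mulA b) (phi a) + tmap id (mulA a \- mulA^~ a) (phi b).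
  exact: lsi_comodalg_phi hopfA a b.
have psiE : psi (comm mulA a b) =
  tmap (mulA a) id (psi b) - tmap (mulA b) id (psi a).
  exact: lsi_comodalg_psi hopfA a b.
rewrite /braided_cocycle_defect biprod_comul_inA phiE psiE /cocycle_defect.
by rewrite !cocycle_actionE !tmapBr; blocks; abel.
Qed.

(** Here each of the three blocks is one axiom: a bimodule coalgebra axiom on
    [A ⊗ A], and a Hopf bimodule axiom on each mixed block. *)
Lemma cocycle_defect_HA x b : cocycle_defect mulE DE (iH x) (iA b) = 0.
Proof.
rewrite /cocycle_defect.
have -> : comm mulE (iH x) (iA b) = iA (l x b - r b x).
  by rewrite /comm !mulE_in (linB lA).
have DE1 : DA (l x b) - DA (r b x) = tmap (l x) id (DA b)
  - tmap id (r^~ x) (DA b) + tmap id (l x) (DA b).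
  exact: lsi_modcoalg_comm hopfA x b.
have phiE : phi (r b x) - phi (l x b) = tmap id (r^~ x) (phi b)
  + tmap id (r b) (DH x) - tmap id (l^~ b) (DH x) - tmap (mulH x) id (phi b)
  - tmap id (l x) (phi b).
  exact: lsh_phi_comm hopf x b.
have psiE : psi (l x b) - psi (r b x) = tmap (l x) id (psi b)
  + tmap id (mulH x \- mulH^~ x) (psi b) - tmap (r b) id (DH x).
  exact: lsh_psi_comm hopf x b.
rewrite biprod_comul_inA (linB DA_lin) DE1 (linB phi_lin) -(opprB (phi _)) phiE.
rewrite (linB psi_lin) psiE tmapBr.
by rewrite !cocycle_actionE; blocks; abel.
Qed.

Lemma cocycle_defect_HH x y : cocycle_defect mulE DE (iH x) (iH y) = 0.
Proof.
have commE : comm mulE (iH x) (iH y) = iH (comm mulH x y).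
  by rewrite /comm !mulE_in (linB lH).
transitivity (HH (cocycle_defect mulH DH x y)).
  by rewrite /cocycle_defect commE !cocycle_actionE; blocks; abel.
rewrite (cocycleP _ _ _ _).1; first exact: lin0 (ltmap lH lH).
exact: lsb_comul_comm bialgH _ _.
Qed.

(** ** The product and the coproduct separately *)

(** Left symmetry exchanges the first two arguments, so the choices of summands
    [AH-] and [HA-] fall under one axiom.  Such an axiom is used twice below, once
    for each of the two arguments that may supply the element of [H]. *)
Lemma biprod_mul_lsym e f g :
  mulE (mulE e f) g - mulE e (mulE f g) = mulE (mulE f e) g - mulE f (mulE e g).
Proof.
case: e f g => [a x] [b y] [c z]; congr (_, _) => /=; last first.
  exact: ls_mul_lsym (lsb_algebra bialgH) x y z.
rewrite !(linD (mulA_bil.1 _)) !(linD (mulA_bil.2 _)) !(linD (l_bil.2 _)).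
rewrite !(linD (r_bil.1 _)).
rewrite (canRL (subrK _) (ls_mul_lsym (lsi_algebra hopfA) a b c)).
rewrite (canRL (subrK _) (lsm_left bimod x y c)).
rewrite (canRL (subrK _) (lsm_right bimod y z a)).
rewrite (canRL (subrK _) (lsm_right bimod x z b)).
rewrite (canRL (subrK _) (lsi_modalg_right hopfA z a b)).
rewrite (canRL (subrK _) (lsi_modalg_left hopfA x b c)).
rewrite (canRL (subrK _) (lsi_modalg_left hopfA y a c)).
by abel.
Qed.

Let comul_comp_inA : DE \o iA = ((AA \o DA) \+ (HA \o phi)) \+ (AH \o psi).
Proof. exact/funext/biprod_comul_inA. Qed.
Let comul_comp_inH : DE \o iH = HH \o DH.
Proof. exact/funext/biprod_comul_inH. Qed.

Let push_comp (V V' W' W : lmodType K) (F : W -> (E ⊗ E)%type)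
    (D : V -> W) (j : V' -> E) t :
  linear F -> linear j -> tmap (F \o D) j t = tmap F j (tmap D id t).
Proof. by move=> hF hj; rewrite tmap_tmap. Qed.

Let tassoc_comp (U V W W' : lmodType K) (i : U -> E) (j : V -> E) (k : W -> E)
    (D : W' -> (V ⊗ W)%type) t :
  linear i -> linear j -> linear k ->
  tassoc (tmap i (tmap j k \o D) t) = tmap (tmap i j) k (tassoc (tmap id D t)).
Proof.
move=> hi hj hk; rewrite -tassoc_tmap // tmap_tmap //; exact: tmap_linear.
Qed.

(** All blocks but [HHH] occur, the coaction of an element of [A] never having
    both legs in [H]. *)
Lemma coassoc_defect_A a :
  coassoc_defect DE (iA a) =
    tmap AA iA (coassoc_defect DA a)
    + tmap HA iA (tmap phi id (DA a) - tassoc (tmap id DA (phi a)))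
    + tmap AH iA (tmap psi id (DA a) - tassoc (tmap id phi (DA a)))
    + tmap AA iH (tmap DA id (psi a) - tassoc (tmap id psi (DA a)))
    + tmap HH iA (tmap DH id (phi a) - tassoc (tmap id phi (phi a)))
    + tmap HA iH (tmap phi id (psi a) - tassoc (tmap id psi (phi a)))
    + tmap AH iH (tmap psi id (psi a) - tassoc (tmap id DH (psi a))).
Proof.
have hDE := biprod_comul_linear; have hT := @tassoc_linear K.
rewrite /coassoc_defect biprod_comul_inA.
rewrite !(linD (ltmap hDE _)) // !(linD (ltmap _ hDE)) //.
rewrite !tmap_tmap // !comul_comp_inA !comul_comp_inH.
rewrite !tmapDl !tmapDr !(linD (hT _ _ _)).
rewrite !tassoc_comp // !push_comp //; try exact: ltmap.
by rewrite !(linB (ltmap (ltmap _ _) _)) //; abel.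
Qed.

Lemma coassoc_defect_H x :
  coassoc_defect DE (iH x) = tmap HH iH (coassoc_defect DH x).
Proof.
have hDE := biprod_comul_linear.
rewrite /coassoc_defect biprod_comul_inH !tmap_tmap // !comul_comp_inH.
rewrite tassoc_comp //.
by rewrite push_comp ?(linB (ltmap (ltmap _ _) _)) //; exact: ltmap.
Qed.

Lemma biprod_ls_algebra : ls_algebra mulE.
Proof. exact: LSAlgebra biprod_mul_bilinear biprod_mul_lsym. Qed.

(** The flip of the first two factors permutes the blocks: it fixes [AAA], [AAH],
    [HHA], and exchanges [AHA] with [HAA] and [HAH] with [AHH].  The axioms say
    precisely that the components correspond under this permutation. *)
Lemma biprod_ls_coalgebra : ls_coalgebra DE.
Proof.
split=> [|c]; first exact: biprod_comul_linear.
change (tau12 (coassoc_defect DE c) = coassoc_defect DE c).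
have hT := @tau12_linear K.
rewrite [c]inA_inH coassoc_defectD; last exact: biprod_comul_linear.
rewrite (linD (hT _ _ _)); congr (_ + _); last first.
  rewrite coassoc_defect_H tau12_tmap //; congr tmap.
  exact: ls_comul_lsym (lsb_coalgebra bialgH) _.
have AAA : tau12 (coassoc_defect DA c.1) = coassoc_defect DA c.1.
  exact: ls_comul_lsym (lsi_coalgebra hopfA) _.
have HAA : tmap phi id (DA c.1) - tassoc (tmap id DA (phi c.1)) =
    tau12 (tmap psi id (DA c.1) - tassoc (tmap id phi (DA c.1))).
  apply: oppr_inj; rewrite -(linN (hT _ _ _)) !opprB.
  exact: lsi_comodcoalg_left hopfA _.
have AAH : tau12 (tmap DA id (psi c.1) - tassoc (tmap id psi (DA c.1))) =
    tmap DA id (psi c.1) - tassoc (tmap id psi (DA c.1)).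
  exact: lsi_comodcoalg_right hopfA _.
have HHA : tau12 (tmap DH id (phi c.1) - tassoc (tmap id phi (phi c.1))) =
    tmap DH id (phi c.1) - tassoc (tmap id phi (phi c.1)).
  exact: lsc_left bicomod _.
have AHH : tmap psi id (psi c.1) - tassoc (tmap id DH (psi c.1)) =
    tau12 (tmap phi id (psi c.1) - tassoc (tmap id psi (phi c.1))).
  exact: lsc_right bicomod _.
rewrite coassoc_defect_A; move: AAA HAA AAH HHA AHH.
move: (coassoc_defect DA _) (tmap phi id (DA _) - _) (tmap psi id (DA _) - _)
  (tmap DA id _ - _) (tmap DH id _ - _) (tmap phi id (psi _) - _)
  (tmap psi id (psi _) - _) => aaa haa aha aah hha hah ahh AAA -> AAH HHA ->.
rewrite !(linD (hT _ _ _)) !tau12_tmap // !tau12K AAA AAH HHA; abel.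
Qed.

(** ** Comparison of the compatibilities *)

Lemma braided_cocycleP a b :
  DA (comm mulA a b) =
    (\tsum_(b1, b2 <- DA b) mulA a b1 ⊗ b2)
    + (\tsum_(b1, b2 <- DA b) b1 ⊗ comm mulA a b2)
    - (\tsum_(a1, a2 <- DA a) mulA b a1 ⊗ a2)
    - (\tsum_(a1, a2 <- DA a) a1 ⊗ comm mulA b a2)
    + (\tsum_(a0, h <- psi a) a0 ⊗ l h b)
    + (\tsum_(h, b0 <- phi b) r a h ⊗ b0)
    + (\tsum_(b0, h <- psi b) b0 ⊗ r a h)
    - (\tsum_(b0, h <- psi b) b0 ⊗ l h a)
    - (\tsum_(h, a0 <- phi a) r b h ⊗ a0)
    - (\tsum_(a0, h <- psi a) a0 ⊗ r b h)
  <-> braided_cocycle_defect a b = 0.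
Proof.
rewrite /braided_cocycle_defect /cocycle_defect /cocycle_action /tmap.
split=> [->|/subr0_eq /(canRL (subrK _)) ->]; abel.
Qed.

Lemma braided_leibnizP a b :
  idmtau (DA (mulA a b)) = idmtau (
      (\tsum_(a1, a2 <- DA a) a1 ⊗ mulA a2 b)
      + (\tsum_(b1, b2 <- DA b) mulA a b1 ⊗ b2)
      + (\tsum_(b1, b2 <- DA b) b1 ⊗ mulA a b2)
      + (\tsum_(a0, h <- psi a) a0 ⊗ l h b)
      + (\tsum_(h, b0 <- phi b) r a h ⊗ b0)
      + (\tsum_(b0, h <- psi b) b0 ⊗ r a h))
  <-> braided_leibniz_defect a b = 0.
Proof.
rewrite /braided_leibniz_defect idmtauB.
by split=> [->|/subr0_eq]; [exact: subrr|].
Qed.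

Lemma biprod_cocycleP :
  (forall e f, cocycle_defect mulE DE e f = 0)
  <-> (forall a b, braided_cocycle_defect a b = 0).
Proof.
split=> defect0 => [a b|e f].
  apply: (@block_AA_inj K H A).
  by rewrite -cocycle_defect_AA defect0 (lin0 (ltmap lA lA)).
have [mE dE] := (biprod_mul_bilinear, biprod_comul_linear).
rewrite [e]inA_inH [f]inA_inH cocycle_defectDl // !cocycle_defectDr //.
rewrite cocycle_defect_AA defect0 (lin0 (ltmap lA lA)).
rewrite [cocycle_defect _ _ (iA _) (iH _)]cocycle_defectC // !cocycle_defect_HA.
by rewrite cocycle_defect_HH oppr0 !addr0.
Qed.

Lemma biprod_leibnizP :
  (forall e f, leibniz_defect mulE DE e f = 0)
  <-> (forall a b, braided_leibniz_defect a b = 0).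
Proof.
split=> defect0 => [a b|e f].
  apply: (@block_AA_inj K H A).
  by rewrite -leibniz_defect_AA defect0 (lin0 (ltmap lA lA)).
have [mE dE] := (biprod_mul_bilinear, biprod_comul_linear).
rewrite [e]inA_inH [f]inA_inH leibniz_defectDl // !leibniz_defectDr //.
rewrite leibniz_defect_AA defect0 (lin0 (ltmap lA lA)).
by rewrite leibniz_defect_AH leibniz_defect_HA leibniz_defect_HH !addr0.
Qed.

End Biproduct.

Theorem theorem3p3 (K : fieldType) (charK0 : [pchar K] =i pred0)
  (H A : lmodType K)
  (mulH : H -> H -> H) (DH : H -> (H ⊗ H)%type)
  (mulA : A -> A -> A) (DA : A -> (A ⊗ A)%type)
  (l : H -> A -> A) (r : A -> H -> A)
  (phi : A -> (H ⊗ A)%type) (psi : A -> (A ⊗ H)%type)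
  (bialgH : ls_bialgebra mulH DH)
  (algcoalgA : ls_algebra_coalgebra_in mulH DH mulA DA l r phi psi) :
  ls_bialgebra (biprod_mul mulH mulA l r) (biprod_comul DH DA phi psi)
  <-> braided_ls_bialgebra mulH DH mulA DA l r phi psi.
Proof.
have commP := biprod_cocycleP bialgH algcoalgA.
have mulP := biprod_leibnizP bialgH algcoalgA.
split=> [bialgE|brd].
- split=> // a b.
  + apply/braided_cocycleP; apply: commP.1 => e f.
    exact/cocycleP/(lsb_comul_comm bialgE).
  + apply/braided_leibnizP; apply: mulP.1 => e f.
    exact/leibnizP/(lsb_comul_mul bialgE).
- split.
  + exact: biprod_ls_algebra bialgH algcoalgA.
  + exact: biprod_ls_coalgebra bialgH algcoalgA.
  + move=> e f; apply/cocycleP; apply: commP.2 => a b.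
    exact/braided_cocycleP/(brd_comul_comm brd).
  + move=> e f; apply/leibnizP; apply: mulP.2 => a b.
    exact/braided_leibnizP/(brd_comul_mul brd).
Qed.
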